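(* Let $\epsilon>0$. For all sufficiently large $m$, every odd integer $t$ with $3\le t\le \frac{1}{10}\lg\lg m$ and every positive integer $n\le m^{1-\epsilon}$, \[ s(m,n,t)=O\!\left(\exp(e^{2t})\, m^{\frac{2}{t+1}} n^{1-\frac{2}{t+1}}\lg m\right). \]
   Context: $\lg$ denotes logarithm to base $2$. Let $[m]=\{1,\dots,m\}$. An $(m,n,s)$-storing scheme is a map $\phi$ from the family of subsets of $[m]$ of size at most $n$ to $\{0,1\}^s$. An $(m,s,t)$-query scheme is a family $\{T_u\}_{u\in[m]}$ of Boolean decision trees of depth at most $t$ whose internal nodes are marked with addresses in $\{1,\dots,s\}$ (with outgoing edges labelled $0$ and $1$, so probes may be adaptive) and whose leaves are marked Yes/No. An $(m,n,s,t)$-scheme is a pair $(\phi,\{T_u\})$ such that for every $S\subseteq[m]$ with $|S|\le n$ and every $u\in[m]$, $T_u(\phi(S))=\mathrm{Yes}$ iff $u\in S$. $s(m,n,t)$ is the minimum $s$ for which an $(m,n,s,t)$-scheme exists. *)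

(* Defs.v *)
From mathcomp Require Import all_boot all_order all_algebra.
From mathcomp Require Import boolp reals sequences exp.

Set Implicit Arguments.
Unset Strict Implicit.
Unset Printing Implicit Defensive.

Import Order.TTheory GRing.Theory Num.Theory.

(* The universe [m] = {1, ..., m} and the addresses {1, ..., s} are shifted to
   'I_m and 'I_s; a memory content, i.e. an element of {0,1}^s, is an
   s.-tuple bool. *)

(* In [Probe i T0 T1], T0 (resp. T1) is the subtree reached when the bit read
   at address i is 0 (resp. 1); [Leaf true] is a leaf marked Yes. *)
Inductive dtree (s : nat) : Type :=
| Leaf of bool
| Probe of 'I_s & dtree s & dtree s.

Fixpoint depth (s : nat) (T : dtree s) : nat :=
  match T with
  | Leaf _ => 0
  | Probe _ T0 T1 => (maxn (depth T0) (depth T1)).+1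
  end.

Fixpoint answer (s : nat) (T : dtree s) (x : s.-tuple bool) : bool :=
  match T with
  | Leaf b => b
  | Probe i T0 T1 => if tnth x i then answer T1 x else answer T0 x
  end.

Definition storing_scheme (m n s : nat) : Type :=
  {S : {set 'I_m} | #|S| <= n} -> s.-tuple bool.

Definition query_scheme (m s t : nat) : Type :=
  'I_m -> {T : dtree s | depth T <= t}.

Record scheme (m n s t : nat) : Type := Scheme {
  storing : storing_scheme m n s;
  query : query_scheme m s t;
  schemeP : forall (S : {S : {set 'I_m} | #|S| <= n}) (u : 'I_m),
    answer (sval (query u)) (storing S) = (u \in sval S)
}.

(* The characteristic vector, read with a single probe. *)
Lemma ex_scheme (m n t : nat) : 0 < t -> exists s, `[< inhabited (scheme m n s t) >].
Proof.
move=> t_gt0; exists m; apply/asboolP.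
pose phi (S : {S : {set 'I_m} | #|S| <= n}) := [tuple i \in sval S | i < m].
pose T (u : 'I_m) := Probe u (Leaf m false) (Leaf m true).
have dT u : depth (T u) <= t by [].
constructor; apply: (@Scheme _ _ _ _ phi (fun u => exist _ (T u) (dT u))).
by move=> S u /=; rewrite tnth_mktuple; case: ifP.
Qed.

(* The minimum s for which a scheme exists. One exists whenever 0 < t
   (ex_scheme); the value 0 is a dummy for when there is none, which can only
   happen for t = 0. *)
Definition min_space (m n t : nat) : nat :=
  if pselect (exists s, `[< inhabited (scheme m n s t) >]) is left ex_s
  then ex_minn ex_s else 0.

Lemma min_spaceP (m n t : nat) : 0 < t ->
  inhabited (scheme m n (min_space m n t) t) /\
  forall s, inhabited (scheme m n s t) -> min_space m n t <= s.
Proof.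
move=> /(ex_scheme m n) ex_s; rewrite /min_space.
case: pselect => [ex_s'|//]; case: ex_minnP => s /asboolP sch s_min.
by split=> // s' /asboolP /s_min.
Qed.

Definition lg (R : realType) (x : R) : R := (ln x / ln 2)%R.

(* Main.v *)
Require Import Defs.
From mathcomp Require Import all_boot all_order all_algebra.
From mathcomp Require Import boolp reals sequences exp.
From mathcomp Require Import zify ring lra.
Import Order.TTheory GRing.Theory Num.Theory.

(* Write t = 2d - 1. The query of u probes d - 2 gate cells, stopping with No at
   the first 0, then walks down a complete binary tree with d + 1 levels, a bit
   read at a node choosing the child; the bit read at the bottom is the answer.
   All cells are hashed, gates and nodes having an array of size s each, with
   s^d of order m n^(d-1) (lg m)^d.
   Gate cells are 1 when some element of S is hashed there, and only elements of
   S write a 1 in a bottom cell. So the only elements that need care are those of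
   S and those that collide with S at every gate and at some bottom node: call
   them active. All non-bottom nodes of the tree may then be written freely.
   A union bound gives a hash such that every set Y of active elements occupies
   at least (D - d)|Y| tree cells, D being the number of nodes. By Hall's theorem
   each active element owns all but d of its nodes, with no cell owned twice, and
   losing d nodes on d + 1 levels is not enough to prevent an owner from forcing
   the answer, whatever the other cells contain. *)

Set Implicit Arguments.
Unset Strict Implicit.
Unset Printing Implicit Defensive.

Local Open Scope nat_scope.

(** * Hall's theorem, with multiplicities *)

Lemma subset_of_card (T : finType) (A : {set T}) (r : nat) :
  r <= #|A| -> exists2 R : {set T}, R \subset A & #|R| = r.
Proof.
move=> rA; exists [set x in take r (enum A)].
  by apply/subsetP=> x; rewrite inE => /mem_take; rewrite mem_enum.
rewrite cardsE; have/card_uniqP-> : uniq (take r (enum A)).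
  by rewrite take_uniq ?enum_uniq.
by rewrite size_take -cardE; case: ltngtP rA.
Qed.

(* Rado's proof of Hall's theorem: as long as some set has two elements, one of
   them can be dropped without breaking the hypothesis. *)
Lemma hall (A B : finType) (D : {set A}) (adj : A -> {set B}) :
    (forall Y : {set A}, Y \subset D -> #|Y| <= #|\bigcup_(a in Y) adj a|) ->
  exists2 f : A -> {set B},
    forall a, a \in D -> f a \subset adj a /\ #|f a| = 1
    & forall a b, a \in D -> b \in D -> a != b -> [disjoint f a & f b].
Proof.
have [N] := ubnP (\sum_(a in D) #|adj a|).
elim: N adj => // N IH adj ltN hallP.
case: (boolP [exists a in D, 1 < #|adj a|]); last first.
  move=> /existsPn small.
  have card1 a : a \in D -> #|adj a| = 1.
    move=> aD; have:= small a; rewrite aD /= -leqNgt => le1.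
    have := hallP [set a]; rewrite sub1set aD cards1 big_set1 => /(_ isT); lia.
  exists adj => [a aD|a b aD bD ab]; first by split; rewrite ?card1.
  have := hallP [set a; b]; rewrite subUset !sub1set aD bD cards2 ab.
  rewrite bigcup_setU !big_set1 => /(_ isT).
  have := cardsUI (adj a) (adj b); rewrite !card1 // -setI_eq0 -cards_eq0; lia.
move=> /exists_inP[a aD /card_gt1P[b1 [b2 [b1a b2a b12]]]].
pose del b x := if x == a then adj x :\ b else adj x.
have del_sub b x : del b x \subset adj x.
  by rewrite /del; case: ifP => // _; rewrite subsetDl.
have [ok|/existsPn/= bad] :=
  boolP [exists b in [set b1; b2], [forall (Y : {set A} | Y \subset D),
    #|Y| <= #|\bigcup_(x in Y) del b x|]].
  have {ok}[b bP /forall_inP ok] := exists_inP ok.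
  have ba : b \in adj a by move: bP; rewrite !inE => /orP[]/eqP->.
  have [||f f1 f2] := IH (del b).
  - rewrite (leq_trans _ (ltN : _ <= N)) // (bigD1 a aD) [ltnRHS](bigD1 a aD) /=.
    rewrite -addSn leq_add //; first by rewrite /del eqxx [ltnRHS](cardsD1 b) ba.
    by apply: leq_sum => x _; apply: subset_leq_card.
  - by move=> Y /ok.
  - exists f => // x xD; have [s1 s2] := f1 x xD; split=> //.
    exact: subset_trans s1 (del_sub b x).
have wit b : b \in adj a -> b \in [set b1; b2] ->
    exists Y : {set A}, [/\ Y \subset D, a \in Y & #|\bigcup_(x in Y) del b x| < #|Y|].
  move=> ba bP; have := bad b; rewrite bP /= => /forall_inPn[Y YD].
  rewrite -ltnNge => ltY; exists Y; split=> //; apply: contraLR ltY => aY.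
  rewrite -leqNgt (leq_trans (hallP Y YD)) // subset_leq_card //.
  apply/bigcupsP=> x xY; rewrite (bigcup_max x) // /del; case: eqP xY => // ->.
  by rewrite (negPf aY).
have [|Y1 [Y1D aY1 lt1]] := wit b1 b1a; first by rewrite !inE eqxx.
have [|Y2 [Y2D aY2 lt2]] := wit b2 b2a; first by rewrite !inE eqxx orbT.
(* Submodularity: as [b1] and [b2] differ, [N1 :|: N2] contains all neighbours of [Y1 :|: Y2], and
   [N1 :&: N2] contains those of [(Y1 :&: Y2) :\ a]. Adding the two Hall inequalities gives |N1| +
   |N2| >= |Y1| + |Y2| - 1, against [lt1] and [lt2]. *)
exfalso; set N1 := \bigcup_(x in Y1) _ in lt1; set N2 := \bigcup_(x in Y2) _ in lt2.
have leU : #|Y1 :|: Y2| <= #|N1 :|: N2|.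
  rewrite (leq_trans (hallP _ _)) ?subUset ?Y1D //; apply: subset_leq_card.
  apply/bigcupsP=> x xY; apply/subsetP=> b bx.
  have mem c (Y : {set A}) : x \in Y -> (x != a) || (b != c) ->
      b \in \bigcup_(x in Y) del c x.
    move=> xYc neq; apply/bigcupP; exists x => //; rewrite /del.
    by case: eqP neq bx => [->|//] /=; rewrite !inE => -> ->.
  rewrite inE; case: (eqVneq x a) => [xa|xa].
    case: (eqVneq b b1) => [bb|bb].
      by rewrite (mem b2 Y2) ?orbT ?xa // bb b12 orbT.
    by rewrite (mem b1 Y1) ?xa // bb orbT.
  move: xY; rewrite inE => /orP[xY|xY]; first by rewrite (mem b1 Y1) ?xa.
  by rewrite (mem b2 Y2) ?xa ?orbT.
have leI : #|(Y1 :&: Y2) :\ a| <= #|N1 :&: N2|.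
  rewrite (leq_trans (hallP _ _)) //.
    by rewrite (subset_trans _ Y1D) // (subset_trans (subsetDl _ _)) ?subsetIl.
  apply/subset_leq_card/bigcupsP=> x; rewrite !inE => /and3P[xa x1 x2].
  rewrite subsetI; apply/andP; split; apply: (bigcup_max x) => //;
  by rewrite /del (negPf xa).
have := cardsUI Y1 Y2; have := cardsUI N1 N2; have := cardsD1 a (Y1 :&: Y2).
rewrite inE aY1 aY2 /=; lia.
Qed.

(** Hall's theorem for [c] copies of each element of [D]: a set of copies projecting onto [Z] has at
    most [c * #|Z|] elements and the same neighbours as [Z]. *)
Lemma hall_mult (A B : finType) (c : nat) (D : {set A}) (adj : A -> {set B}) :
    (forall Y : {set A}, Y \subset D -> c * #|Y| <= #|\bigcup_(a in Y) adj a|) ->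
  exists2 f : A -> {set B},
    forall a, a \in D -> f a \subset adj a /\ #|f a| = c
    & forall a b, a \in D -> b \in D -> a != b -> [disjoint f a & f b].
Proof.
move=> hallP.
have [Y YD|f f1 f2] := @hall _ _ (setX D [set: 'I_c]) (fun p => adj p.1).
  set Z := [set p.1 | p in Y].
  have ZD : Z \subset D.
    by apply/subsetP=> _ /imsetP[p /(subsetP YD) + ->]; rewrite inE => /andP[].
  have -> : \bigcup_(p in Y) adj p.1 = \bigcup_(a in Z) adj a.
    apply/eqP; rewrite eqEsubset; apply/andP; split; apply/bigcupsP.
      by move=> p pY; rewrite (bigcup_max p.1) ?imset_f.
    by move=> _ /imsetP[p pY ->]; rewrite (bigcup_max p).
  rewrite (leq_trans _ (hallP Z ZD)) // mulnC -[c in leqRHS]card_ord -[#|'I_c|]cardsT.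
  rewrite -cardsX subset_leq_card //; apply/subsetP=> -[a i] aY.
  by rewrite in_setX inE andbT; apply/imsetP; exists (a, i).
exists (fun a => \bigcup_(i < c) f (a, i)) => [a aD|a b aD bD ab].
  have fP i := f1 (a, i); have {}fP i : f (a, i) \subset adj a /\ #|f (a, i)| = 1.
    by apply: fP; rewrite inE aD inE.
  split; first by apply/bigcupsP=> i _; case: (fP i).
  rewrite -sum1_card partition_disjoint_bigcup /=.
    rewrite -[RHS]card_ord -sum1_card; apply: eq_bigr => i _.
    by rewrite sum1_card; case: (fP i).
  by move=> i j ij; apply: f2; rewrite ?inE ?aD // xpair_eqE eqxx.
rewrite -setI_eq0 -subset0; apply/subsetP=> x /setIP[/bigcupP[i _ xi] /bigcupP[j _ xj]].
have := f2 (a, i) (b, j); rewrite !inE aD bD xpair_eqE negb_and ab => /(_ isT isT isT).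
by move/disjointFr => /(_ x xi); rewrite xj.
Qed.

(** * Complete binary trees and forcing the outcome of a walk *)

(* The complete binary tree with d.+1 (not d) levels; true is the right child. *)
Fixpoint node (d : nat) : finType :=
  if d is d'.+1 then (unit + bool * node d')%type else unit.

Fixpoint bottom (d : nat) : node d -> bool :=
  if d is d'.+1 then fun z => if z is inr (_, z') then bottom z' else false
  else fun _ => true.

Fixpoint walk (d : nat) : (node d -> bool) -> bool :=
  if d is d'.+1 then
    fun mem => walk (fun z => mem (inr (mem (inl tt), z)))
  else fun mem => mem tt.

Lemma card_node (d : nat) : #|node d| = 2 ^ d.+1 - 1.
Proof.
elim: d => [|d IH]; first by rewrite card_unit.
rewrite card_sum card_prod card_unit card_bool IH !expnS; lia.
Qed.

Lemma walk_bottom (d : nat) (b : bool) (mem : node d -> bool) :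
  (forall z, bottom z -> mem z = b) -> walk mem = b.
Proof.
elim: d mem => [|d IH] mem memb /=; first exact: memb.
by apply: IH => z bz; apply: memb.
Qed.

Lemma card_pred_branch (T : finType) (P : pred (unit + bool * T)) :
  #|P| = P (inl tt) + (#|[pred z | P (inr (true, z))]| + #|[pred z | P (inr (false, z))]|).
Proof.
rewrite -!sum1_card big_mkcond big_sumType /=; congr (_ + _).
  by rewrite (eq_bigl (pred1 tt)) ?big_pred1_eq; [case: ifP; rewrite /in_mem /= => -> | case].
rewrite (eq_bigr (fun p : bool * T => if inr (p.1, p.2) \in P then 1 else 0));
  last by case.
rewrite -(pair_bigA _ (fun b z => if inr (b, z) \in P then 1 else 0)) big_bool /=.
by rewrite -!big_mkcond.
Qed.

(* A lost root is harmless: each subtree keeps at most d.-1 lost nodes. Otherwise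
   walk to a subtree with at most half of the lost nodes. *)
Lemma strategy (d : nat) (b : bool) (lost : pred (node d)) :
    #|lost| <= d ->
  exists2 val : node d -> bool, forall z, bottom z -> val z = b
    & forall mem : node d -> bool,
        (forall z, ~~ lost z -> mem z = val z) -> walk mem = b.
Proof.
elim: d lost => [|d IH] lost.
  rewrite leqn0 => /eqP/card0_eq lost0; exists (fun=> b) => // mem memP /=.
  by apply: memP; rewrite -[lost tt]/(tt \in lost) lost0.
pose sub c : simpl_pred (node d) := [pred z | lost (inr (c, z))].
rewrite (@card_pred_branch (node d) lost) -/(sub true) -/(sub false) => le_lost.
have [c cP] : exists c, #|sub c| <= d /\ (lost (inl tt) -> #|sub (~~ c)| <= d).
  case: (leqP #|sub true| d) => [le_t|lt_d]; [exists true|exists false].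
    split=> // lt; move: le_lost; rewrite lt add1n ltnS -[~~ true]/false.
    by apply: leq_trans; apply: leq_addl.
  move: le_lost; case: (lost _) => le_lost; split=> //.
  - by rewrite leqNgt; apply/negP; lia.
  - by move=> _; rewrite -[~~ false]/true; lia.
  - by lia.
have win e : #|sub e| <= d -> exists val : node d -> bool,
    (forall z, bottom z -> val z = b) /\
    forall mem : node d -> bool, (forall z, ~~ sub e z -> mem z = val z) -> walk mem = b.
  by move=> /IH[val v1 v2]; exists val.
have [v [vb vP]] := win c cP.1.
(* If the root is not lost, it sends the walk to [c] and the other subtree is never entered; the
   constant [b] is then only there to meet the condition on the bottom. *)
have [w [wb wP]] : exists val : node d -> bool,
    (forall z, bottom z -> val z = b) /\ (lost (inl tt) ->
    forall mem : node d -> bool, (forall z, ~~ sub (~~ c) z -> mem z = val z) -> walk mem = b).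
  case: (boolP (lost (inl tt))) => [lt|_]; last by exists (fun=> b).
  by have [w [wb wP]] := win _ (cP.2 lt); exists w.
exists (fun z : node d.+1 => match z with
  | inl _ => c | inr (e, z') => if e == c then v z' else w z' end).
  by case=> [//|[e z]] /=; case: eqP => _; [exact: vb|exact: wb].
move=> mem memP /=; case: (eqVneq (mem (inl tt)) c) => [->|neq].
  by apply: vP => z lz; rewrite (memP (inr (c, z)) lz) eqxx.
have lt : lost (inl tt) by apply: contraT => /memP mc; rewrite mc eqxx in neq.
have -> : mem (inl tt) = ~~ c by case: (mem _) (c) neq => -[].
apply: (wP lt) => z lz; rewrite (memP (inr (~~ c, z)) lz).
by case: (c).
Qed.

(** * Decision trees of the queries *)

Fixpoint btree (s d : nat) : (node d -> 'I_s) -> dtree s :=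
  match d with
  | 0 => fun loc => Probe (loc tt) (Leaf s false) (Leaf s true)
  | d'.+1 => fun loc => Probe (loc (inl tt))
      (btree (fun z => loc (inr (false, z)))) (btree (fun z => loc (inr (true, z))))
  end.

Lemma depth_btree (s d : nat) (loc : node d -> 'I_s) : depth (btree loc) = d.+1.
Proof. by elim: d loc => //= d IH loc; rewrite !IH maxnn. Qed.

Lemma answer_btree (s d : nat) (loc : node d -> 'I_s) (x : s.-tuple bool) :
  answer (btree loc) x = walk (fun z => tnth x (loc z)).
Proof.
elim: d loc => [|d IH] loc /=; first by case: (tnth _ _).
by case: (tnth x (loc (inl tt))); rewrite IH.
Qed.

Definition gated (s : nat) (a : seq 'I_s) (T : dtree s) : dtree s :=
  foldr (fun i => Probe i (Leaf s false)) T a.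

Lemma depth_gated (s : nat) (a : seq 'I_s) (T : dtree s) :
  depth (gated a T) = size a + depth T.
Proof. by elim: a => //= i a ->; rewrite max0n addSn. Qed.

Lemma answer_gated (s : nat) (a : seq 'I_s) (T : dtree s) (x : s.-tuple bool) :
  answer (gated a T) x = all (tnth x) a && answer T x.
Proof. by elim: a => //= i a ->; case: (tnth _ _). Qed.

(** * From a good hash to a scheme *)

(* h (u, inl i) is the cell of the i-th gate of u in the i-th gate array, and
   h (u, inr z) its cell for the tree node z in the array of z. *)
Definition hash (m j d s : nat) : finType := {ffun 'I_m * ('I_j + node d) -> 'I_s}.

(** Arrays are separate, so only positions with the same second component can collide. An element of
    [S] hits itself at each of its positions. *)
Definition hit (m j d s : nat) (h : hash m j d s) (S : {set 'I_m})
    (p : 'I_m * ('I_j + node d)) : bool :=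
  [exists x in S, h (x, p.2) == h p].

Definition active (m j d s : nat) (h : hash m j d s) (S : {set 'I_m}) : {set 'I_m} :=
  S :|: [set u | [forall i, hit h S (u, inl i)] &
                 [exists z, bottom z && hit h S (u, inr z)]].

Definition cells (m j d s : nat) (h : hash m j d s) (Y : {set 'I_m}) :
    {set node d * 'I_s} :=
  \bigcup_(u in Y) [set (z, h (u, inr z)) | z in [set: node d]].

(** Hall's condition of [hall_mult] for the active elements, each claiming all but [d] of its tree
    cells. *)
Definition good (m j d s n : nat) (h : hash m j d s) : Prop :=
  forall S Y : {set 'I_m}, #|S| <= n -> Y \subset active h S ->
    (#|node d| - d) * #|Y| <= #|cells h Y|.

Lemma scheme_of_hash (m j d s n : nat) (h : hash m j d s) :
  good n h -> inhabited (scheme m n #|{: ('I_j + node d) * 'I_s}| (j + d.+1)).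
Proof.
move=> goodh.
pose adr (z : 'I_j + node d) (c : 'I_s) := enum_rank (z, c).
pose T u := gated [seq adr (inl i) (h (u, inl i)) | i <- enum 'I_j]
                  (btree (fun z => adr (inr z) (h (u, inr z)))).
have dT u : depth (T u) <= j + d.+1.
  by rewrite depth_gated depth_btree size_map size_enum_ord.
suff store (S : {S : {set 'I_m} | #|S| <= n}) :
    exists x : #|{: ('I_j + node d) * 'I_s}|.-tuple bool,
      [forall u, answer (T u) x == (u \in sval S)].
  constructor; apply: (@Scheme _ _ _ _ (fun S => xchoose (store S))
    (fun u => exist _ (T u) (dT u))) => S u /=.
  by have /forallP/(_ u)/eqP := xchooseP (store S).
case: S => S leS /=.
have [Y YS|own own1 own2] := @hall_mult _ _ (#|node d| - d) (active h S)
    (fun u => [set (z, h (u, inr z)) | z in [set: node d]]).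
  exact: goodh leS YS.
(* An owner keeps [#|node d| - d] cells, so at most [d] nodes are lost, exactly what [strategy]
   tolerates. *)
pose lost u : pred (node d) := fun z => (z, h (u, inr z)) \notin own u.
have lost_small u : u \in active h S -> #|lost u| <= d.
  move=> /own1[sub card_own].
  have cardD : #|~: [set z | lost u z]| = #|node d| - d.
    rewrite -card_own.
    rewrite -(card_imset (f := fun z => (z, h (u, inr z)))); last by move=> z z' [].
    apply: eq_card => p; apply/imsetP/idP => [[z]|pu].
      by rewrite !inE negbK => zu ->.
    have /imsetP[z _ pE] := subsetP sub p pu; exists z => //.
    by rewrite !inE negbK -pE.
  rewrite -(eq_card (A := [set z | lost u z])); last by move=> z; rewrite inE.
  by have := cardsC [set z | lost u z]; rewrite cardD; lia.
have strat u : exists val : node d -> bool, u \in active h S ->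
    (forall z, bottom z -> val z = (u \in S)) /\
    forall mem : node d -> bool,
      (forall z, ~~ lost u z -> mem z = val z) -> walk mem = (u \in S).
  case: (boolP (u \in active h S)) => [uA|_]; last by exists (fun=> false).
  by have [v v1 v2] := strategy (u \in S) (lost_small u uA); exists v.
have {strat}[val valP] := choice strat.
(* A tree cell obeys its owner, unique by [own2], and holds 0 if it has none. *)
pose cell (p : ('I_j + node d) * 'I_s) : bool := match p.1 with
  | inl i => [exists x in S, h (x, inl i) == p.2]
  | inr z => [exists u in active h S, ((z, p.2) \in own u) && val u z]
  end.
exists [tuple cell (enum_val i) | i < _].
have cellE z c : tnth [tuple cell (enum_val i) | i < _] (adr z c) = cell (z, c).
  by rewrite tnth_mktuple /adr enum_rankK.
have cell_own u z : u \in active h S -> ~~ lost u z ->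
    cell (inr z, h (u, inr z)) = val u z.
  move=> uA; rewrite negbK => zu; apply/exists_inP/idP => /= [[v vA /andP[zv]]|vz].
    by have [->//|vu] := eqVneq v u; rewrite (disjointFr (own2 _ _ vA uA vu) zv) in zu.
  by exists u; rewrite ?zu.
apply/forallP=> u; apply/eqP; rewrite answer_gated answer_btree.
rewrite all_map (eq_all (a2 := fun i => hit h S (u, inl i))); last first.
  by move=> i /=; rewrite cellE.
have [uA|uA] := boolP (u \in active h S).
  have -> : walk (fun z => tnth [tuple cell (enum_val i) | i < _] (adr (inr z) (h (u, inr z))))
      = (u \in S).
    by have [_] := valP u uA; apply=> z lz; rewrite cellE cell_own.
  have [uS|_] := boolP (u \in S); last by rewrite andbF.
  rewrite andbT; apply/allP=> i _; apply/exists_inP; by exists u.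
(* An inactive [u] that passes every gate meets no element of [S] at the bottom. A 1 read there
   would come from an owner in [S] hashed to that cell, so the walk ends in 0. *)
move: uA; rewrite !inE negb_or => /andP[/negPf-> ]; rewrite negb_and.
case: allP => [gates|//]; rewrite /= => nobot; apply: walk_bottom => z bz.
rewrite cellE; apply/exists_inP => /= -[v vA /andP[zv]].
have [vb _] := valP v vA; rewrite vb // => vS; case/orP: nobot => [/forallPn[i]|/existsPn/(_ z)].
  by rewrite gates // mem_enum.
rewrite bz /= => /exists_inP[]; exists v => //=.
have [/subsetP/(_ _ zv)/imsetP[z' _ [<- ->]] _] := own1 v vA.
by [].
Qed.

(** * Counting functions with prescribed collisions *)

(* The values of h outside Q determine h, by induction on the rank. *)
Lemma count_determined (P C : finType) (rk : P -> nat) (Q : {set P}) (g : P -> P) :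
    (forall p, p \in Q -> rk (g p) < rk p) ->
  #|[set h : {ffun P -> C} | [forall p in Q, h (g p) == h p]]| * #|C| ^ #|Q|
    <= #|C| ^ #|P|.
Proof.
move=> rk_g; have [->|[p0 p0Q]] := set_0Vmem Q.
  by rewrite cards0 muln1 -card_ffun max_card.
set H := [set h | _]; have [->|[h0 _]] := set_0Vmem H; first by rewrite cards0.
pose c0 := h0 p0; pose r (h : {ffun P -> C}) := [ffun p => if p \in Q then c0 else h p].
rewrite -(cardsC Q) addnC expnD leq_mul2r; apply/orP; right.
have r_inj : {in H &, injective r}.
  move=> h h'; rewrite !inE => /forall_inP hP /forall_inP hP' /ffunP eqr.
  apply/ffunP=> p; have [k] := ubnP (rk p); elim: k p => // k IH p ltk.
  have [pQ|pQ] := boolP (p \in Q); last by have := eqr p; rewrite !ffunE (negPf pQ).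
  rewrite -(eqP (hP p pQ)) -(eqP (hP' p pQ)); apply: IH.
  by have := rk_g p pQ; lia.
rewrite -(card_in_imset r_inj) -(card_pffun_on c0 (mem (~: Q)) (mem C)) subset_leq_card //.
apply/subsetP=> _ /imsetP[h _ ->]; apply/pffun_onP; split=> [|//].
by apply/subsetP=> p; rewrite !inE ffunE; case: ifP; rewrite ?eqxx.
Qed.

(** A union bound. The factor [c] is the denominator of a probability, kept on the left to stay
    within the natural numbers. *)
Lemma card_bigcup_le (I T : finType) (A : {pred I}) (F : I -> {set T}) (c M : nat) :
  (forall i, i \in A -> #|F i| * c <= M) -> #|\bigcup_(i in A) F i| * c <= #|A| * M.
Proof.
move=> FM; apply: (@leq_trans ((\sum_(i in A) #|F i|) * c)).
  rewrite leq_mul2r; apply/orP; right; elim/big_rec2: _ => [|i a X _ leX].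
    by rewrite cards0.
  by rewrite cardsU (leq_trans (leq_subr _ _)) // leq_add2l.
by rewrite big_distrl -sum_nat_const leq_sum.
Qed.

(** Choose for every [p] in [Q] the candidate it collides with. Each choice function falls under
    [count_determined], and the product counts these functions. *)
Lemma count_constrained (P C : finType) (rk : P -> nat) (Q : {set P})
    (cand : P -> {set P}) :
    (forall p q, p \in Q -> q \in cand p -> rk q < rk p) ->
  #|[set h : {ffun P -> C} | [forall p in Q, [exists q in cand p, h q == h p]]]|
      * #|C| ^ #|Q|
    <= (\prod_(p in Q) #|cand p|) * #|C| ^ #|P|.
Proof.
move=> rk_cand; have [->|[p0 p0Q]] := set_0Vmem Q.
  by rewrite big_set0 cards0 muln1 mul1n -card_ffun max_card.
have -> : \prod_(p in Q) #|cand p| = #|pfamily p0 (mem Q) cand|.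
  by rewrite card_pfamily foldrE big_image.
pose F (g : {ffun P -> P}) := [set h : {ffun P -> C} | [forall p in Q, h (g p) == h p]].
apply: (@leq_trans (#|\bigcup_(g in pfamily p0 (mem Q) cand) F g| * #|C| ^ #|Q|)).
  rewrite leq_mul2r; apply/orP; right; apply/subset_leq_card/subsetP=> h.
  rewrite inE => /forall_inP hP; pose g p := [pick q in cand p | h q == h p].
  (* [p0] is the default value that [pfamily] imposes outside [Q]. *)
  apply/bigcupP; exists [ffun p => if p \in Q then odflt p0 (g p) else p0].
    apply/pfamilyP; split=> [|p pQ].
      by apply/subsetP=> p; rewrite inE ffunE; case: ifP; rewrite ?eqxx.
    rewrite ffunE pQ /g; case: pickP => [q /andP[]//|none].
    by have /exists_inP[q qc qe] := hP p pQ; have := none q; rewrite qc qe.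
  rewrite inE; apply/forall_inP => p pQ; rewrite ffunE pQ /g.
  case: pickP => [q /andP[]//|none].
  by have /exists_inP[q qc qe] := hP p pQ; have := none q; rewrite qc qe.
apply: card_bigcup_le => g /pfamilyP[_ gP]; apply: (@count_determined _ _ rk) => p pQ.
exact: rk_cand pQ (gP p pQ).
Qed.

(** * Counting the bad hashes *)

(** Collisions inside [B] are charged to the larger element, which rules out cyclic constraints. *)
Definition below (m : nat) (B : {set 'I_m}) (u : 'I_m) : {set 'I_m} :=
  [set v in B | v < u].

Definition event (m j d s : nat) (S B : {set 'I_m})
    (Q R : {set 'I_m * ('I_j + node d)}) : {set hash m j d s} :=
  [set h | [forall p in Q, hit h S p] &&
           [forall p in R, hit h (S :|: below B p.1) p]].

(** With rank 0 on [S] and [u + 1] elsewhere, every required collision is with a position of smaller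
    rank. So each position of [Q] costs |S|/s, and each position of [R] at most (|S| + |B|)/s. *)
Lemma card_event (m j d s : nat) (S B : {set 'I_m})
    (Q R : {set 'I_m * ('I_j + node d)}) :
    [disjoint S & B] -> [disjoint Q & R] ->
    {in Q, forall p, p.1 \in B} -> {in R, forall p, p.1 \in B} ->
  #|event s S B Q R| * s ^ (#|Q| + #|R|)
    <= #|S| ^ #|Q| * (#|S| + #|B|) ^ #|R| * #|hash m j d s|.
Proof.
move=> SB QR QB RB.
pose rk (p : 'I_m * ('I_j + node d)) := if p.1 \in S then 0 else p.1.+1.
pose src p := if p \in Q then S else S :|: below B p.1.
pose cand (p : 'I_m * ('I_j + node d)) := [set (v, p.2) | v in src p].
have card_cand p : #|cand p| = #|src p|.
  by rewrite card_imset // => v w [].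
have QRB p : p \in Q :|: R -> p.1 \in B by rewrite inE => /orP[/QB|/RB].
have notS u : u \in B -> u \in S = false by move=> uB; rewrite (disjointFl SB).
have rk_cand p q : p \in Q :|: R -> q \in cand p -> rk q < rk p.
  move=> /QRB pB /imsetP[v vs ->]; rewrite /rk /= (notS _ pB).
  case: ifP => // vS; move: vs; rewrite /src; case: ifP; rewrite ?vS //.
  by rewrite !inE vS /= => _ /andP[_]; rewrite ltnS.
have := @count_constrained _ 'I_s rk _ _ rk_cand.
have -> : #|Q :|: R| = #|Q| + #|R|.
  by rewrite cardsU; move: QR; rewrite -setI_eq0 => /eqP->; rewrite cards0 subn0.
rewrite [#|hash _ _ _ _|]card_ffun !card_ord => le_card.
apply: leq_trans (leq_trans le_card _); rewrite leq_mul2r; apply/orP; right.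
  apply/subset_leq_card/subsetP=> h; rewrite !inE => /andP[/forall_inP hQ /forall_inP hR].
  apply/forall_inP => p pQR; have : hit h (src p) p.
    move: pQR; rewrite inE /src; case: ifP => [pQ _|_ /= pR]; [exact: hQ|exact: hR].
  move=> /exists_inP[v vs vh]; apply/exists_inP; exists (v, p.2) => //.
  exact: imset_f.
rewrite (eq_bigr (fun p => #|src p|)) => [|p _]; last exact: card_cand.
rewrite (eq_bigl [in [predU Q & R]]) => [|p]; last by rewrite !inE.
rewrite bigU //= -!prod_nat_const; apply: leq_mul; apply: leq_prod => p pX.
  by rewrite /src pX.
rewrite /src; case: ifP => [_|_]; first exact: leq_addr.
rewrite cardsU (leq_trans (leq_subr _ _)) // leq_add2l subset_leq_card //.
by apply/subsetP=> v; rewrite inE => /andP[].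
Qed.

Definition tree_pos (m j d : nat) (q : 'I_m * node d) : 'I_m * ('I_j + node d) :=
  (q.1, inr q.2).

Lemma tree_pos_inj (m j d : nat) : injective (@tree_pos m j d).
Proof. by move=> [u z] [v y] [-> ->]. Qed.

Definition gate_pos (m j d : nat) (B : {set 'I_m}) : {set 'I_m * ('I_j + node d)} :=
  [set (q.1, inl q.2) | q in setX B [set: 'I_j]].

Definition choices (m d : nat) (B : {set 'I_m}) (r : nat) : {set {set 'I_m * node d}} :=
  [set R in powerset (setX B [set: node d]) | #|R| == r].

Lemma card_choices (m d : nat) (B : {set 'I_m}) (r : nat) :
  #|choices d B r| <= 2 ^ (#|B| * #|node d|).
Proof.
rewrite -cardsT -cardsX -card_powerset subset_leq_card //.
by apply/subsetP=> R; rewrite inE => /andP[].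
Qed.

(* Witnesses of a bad hash. If Y is small, its own d|Y| collisions are unlikely
   enough to pay for the choice of Y. If Y is large, one pays for S as well and
   uses the collisions with S that make the elements of B = Y \ S active (at all
   gates, and L at the bottom), together with r further collisions R. *)
Definition crowded (m j d s y : nat) : {set hash m j d s} :=
  \bigcup_(Y : {set 'I_m} | #|Y| == y) \bigcup_(R in choices d Y (d * y))
    event s set0 Y set0 (@tree_pos m j d @: R).

Definition overrun (m j d s n b r : nat) : {set hash m j d s} :=
  \bigcup_(S : {set 'I_m} | #|S| == n) \bigcup_(B : {set 'I_m} | (#|B| == b) && [disjoint S & B])
    \bigcup_(L in choices d B b) \bigcup_(R in [set R in choices d B r | [disjoint L & R]])
      event s S B (gate_pos j d B :|: @tree_pos m j d @: L) (@tree_pos m j d @: R).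

Lemma card_subsets (m y : nat) : #|[pred Y : {set 'I_m} | #|Y| == y]| = 'C(m, y).
Proof. by rewrite -[in RHS](card_ord m) -card_draws -[in RHS]cardsE; apply: eq_card => Y; rewrite !inE. Qed.

Lemma choices_sub (m j d : nat) (B : {set 'I_m}) (r : nat) (R : {set 'I_m * node d}) :
  R \in choices d B r ->
  #|@tree_pos m j d @: R| = r /\ {in @tree_pos m j d @: R, forall p, p.1 \in B}.
Proof.
rewrite !inE => /andP[/subsetP RB /eqP <-]; split; first by rewrite card_imset //; exact: tree_pos_inj.
by move=> _ /imsetP[q /RB + ->]; rewrite inE => /andP[].
Qed.

Lemma card_crowded (m j d s y : nat) :
  #|crowded m j d s y| * s ^ (d * y)
    <= 'C(m, y) * (2 ^ (y * #|node d|) * (y ^ (d * y) * #|hash m j d s|)).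
Proof.
rewrite -card_subsets; apply: card_bigcup_le => Y /eqP cardY.
apply: leq_trans (_ : #|choices d Y (d * y)| * (y ^ (d * y) * #|hash m j d s|) <= _).
  apply: card_bigcup_le => R /(choices_sub j)[cardR RY].
  have := @card_event m j d s set0 Y set0 (@tree_pos m j d @: R).
  rewrite -!setI_eq0 !set0I eqxx cardR cards0 cardY expn0 cards0 !mul1n !add0n.
  by apply=> // p; rewrite inE.
by rewrite leq_mul2r -cardY card_choices orbT.
Qed.

(** Union bounds over [S], [B], [L] and [R], one at a time. The [b * j] gate positions and the [b]
    positions of [L] must collide with [S] itself, the [r] others with [S] or [B]. *)
Lemma card_overrun (m j d s n b r : nat) :
  #|overrun m j d s n b r| * s ^ (b * j + b + r)
    <= 'C(m, n) * ('C(m, b) * (2 ^ (b * #|node d|) * (2 ^ (b * #|node d|) *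
         (n ^ (b * j + b) * (n + b) ^ r * #|hash m j d s|)))).
Proof.
rewrite -[in leqRHS](card_subsets m n); apply: card_bigcup_le => S /eqP cardS.
set X := (X in _ <= _ * X).
apply: leq_trans (_ : #|[pred B : {set 'I_m} | (#|B| == b) && [disjoint S & B]]| * X <= _);
  last first.
  rewrite leq_mul2r -card_subsets; apply/orP; right.
  by apply/subset_leq_card/subsetP=> B; rewrite !inE => /andP[].
apply: card_bigcup_le => B /andP[/eqP cardB SB]; rewrite /X {X}.
set X := (X in _ <= _ * X).
apply: leq_trans (_ : #|choices d B b| * X <= _); last first.
  by rewrite leq_mul2r -cardB card_choices orbT.
apply: card_bigcup_le => L /(choices_sub j)[cardL LB]; rewrite /X {X}.
set X := (X in _ <= _ * X).
apply: leq_trans (_ : #|[set R in choices d B r | [disjoint L & R]]| * X <= _); last first.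
  rewrite leq_mul2r -cardB (leq_trans _ (card_choices d B r)) ?orbT //.
  by apply/subset_leq_card/subsetP=> R; rewrite inE => /andP[].
apply: card_bigcup_le => R; rewrite inE => /andP[/(choices_sub j)[cardR RB] LR].
have cardG : #|gate_pos j d B| = b * j.
  by rewrite card_imset ?cardsX ?cardsT ?card_ord ?cardB // => -[u i] [v i'] [-> ->].
have GL : gate_pos j d B :&: @tree_pos m j d @: L = set0.
  apply/setP=> p; rewrite !inE; apply/andP=> -[/imsetP[q _ ->] /imsetP[q' _ []]].
  by [].
have cardQ : #|gate_pos j d B :|: @tree_pos m j d @: L| = b * j + b.
  by rewrite cardsU GL cards0 subn0 cardG cardL.
have := @card_event m j d s S B (gate_pos j d B :|: @tree_pos m j d @: L) (@tree_pos m j d @: R) SB.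
rewrite cardQ cardR cardS cardB; apply=> //.
  rewrite -setI_eq0 setIUl setU_eq0; apply/andP; split.
    apply/eqP/setP=> p; rewrite !inE.
    by apply/andP=> -[/imsetP[q _ ->] /imsetP[q' _ []]].
  rewrite -imsetI; last by move=> p q _ _; apply: tree_pos_inj.
  by move: LR; rewrite -setI_eq0 => /eqP->; rewrite imset0.
move=> p; rewrite inE => /orP[|/LB//].
by case/imsetP=> q + ->; rewrite inE => /andP[].
Qed.

(** * Too few cells force a bad event *)

(** A position that collides neither with [S] nor with a smaller element of [B] opens a new cell
    outside [cells h S]: of two elements sharing a cell, the larger one is hit. *)
Lemma card_tree_fresh (m j d s : nat) (h : hash m j d s) (S B : {set 'I_m}) :
  #|node d| * #|B| <= #|cells h B :\: cells h S| +
    #|[set q in setX B [set: node d] | hit h (S :|: below B q.1) (tree_pos j q)]|.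
Proof.
set X := setX B _; set H := finset _.
have HX : H \subset X by apply/subsetP=> q; rewrite inE => /andP[].
have <- : #|X| = #|node d| * #|B| by rewrite cardsX cardsT mulnC.
rewrite -(cardsID H X) (setIidPr HX) addnC leq_add2r.
pose f (q : 'I_m * node d) := (q.2, h (q.1, inr q.2)).
have f_inj : {in X :\: H &, injective f}.
  have aux (u v : 'I_m) z : (u, z) \in X -> (v, z) \in X -> (v, z) \notin H ->
      h (u, inr z) = h (v, inr z) -> v <= u.
    move=> uX vX; rewrite inE vX /= => nohit eqh; rewrite leqNgt; apply: contra nohit => ltuv.
    apply/exists_inP; exists u; last by rewrite eqh.
    by move: uX; rewrite !inE ltuv => /andP[-> _]; rewrite orbT.
  move=> [u z] [v z'] /setDP[uX uH] /setDP[vX vH] [ez eqh].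
  rewrite -{}ez /= in vX vH eqh *; congr (_, _); apply/val_inj/eqP.
  by rewrite eqn_leq (aux v u z) // (aux u v z).
rewrite -(card_in_imset f_inj) subset_leq_card //.
apply/subsetP=> _ /imsetP[[u z] /setDP[uX uH] ->]; rewrite inE; apply/andP; split.
  apply: contraNN uH => /bigcupP[x xS /imsetP[z' _ [<- eqh]]].
  by rewrite inE uX; apply/exists_inP; exists x; rewrite /= ?eqh ?inE ?xS.
apply/bigcupP; exists u; first by move: uX; rewrite inE => /andP[].
exact: imset_f.
Qed.

(** For empty [S], [card_tree_fresh] leaves more than [d * #|Y|] colliding positions, among which
    [R] is chosen. *)
Lemma sub_crowded (m j d s : nat) (h : hash m j d s) (Y : {set 'I_m}) :
    d <= #|node d| -> #|cells h Y| < (#|node d| - d) * #|Y| ->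
  h \in crowded m j d s #|Y|.
Proof.
move=> dD ltY; have := card_tree_fresh h set0 Y.
have -> : cells h set0 = set0 by rewrite /cells big_set0.
rewrite setD0; set H := finset _ => le_card.
have [|R RH cardR] := @subset_of_card _ H (d * #|Y|).
  by have := leq_mul dD (leqnn #|Y|); move: ltY le_card; rewrite mulnBl; lia.
apply/bigcupP; exists Y => //; apply/bigcupP; exists R.
  rewrite !inE cardR eqxx andbT (subset_trans RH) //.
  by apply/subsetP=> q; rewrite inE => /andP[].
rewrite inE; apply/andP; split; first by apply/forall_inP => p; rewrite inE.
apply/forall_inP => _ /imsetP[q qR ->].
by have := subsetP RH q qR; rewrite inE => /andP[].
Qed.

Lemma sub_overrun (m j d s : nat) (h : hash m j d s) (S Y : {set 'I_m}) :
    2 <= d <= #|node d| -> Y \subset active h S ->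
    #|cells h Y| < (#|node d| - d) * #|Y| ->
    #|node d| * #|S| <= #|Y :\: S| ->
  h \in overrun m j d s #|S| #|Y :\: S| (#|Y :\: S| - #|node d| * #|S|).
Proof.
move=> /andP[d2 dD] YA ltY leB; set B := Y :\: S in leB *.
have := card_tree_fresh h S B; set H := finset _ => le_card.
have cardYB : #|Y| <= #|S| + #|B|.
  by rewrite -(cardsID S Y) leq_add2r subset_leq_card // subsetIr.
have cellsB : #|cells h B :\: cells h S| <= #|cells h Y|.
  apply/subset_leq_card/subsetP=> c; rewrite inE => /andP[_ /bigcupP[u]].
  by rewrite inE => /andP[_ uY] uc; apply/bigcupP; exists u.
have BA u : u \in B -> (forall i, hit h S (u, inl i)) /\
    exists z, bottom z && hit h S (u, inr z).
  rewrite inE => /andP[/negPf uS /(subsetP YA)]; rewrite !inE uS /=.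
  by move=> /andP[/forallP ? /existsP].
have /card_gt0P[z0 _] : 0 < #|node d| by lia.
have /choice[f fP] : forall u, exists z, u \in B -> bottom z && hit h S (u, inr z).
  move=> u; have [/BA[_ [z zP]]|_] := boolP (u \in B); [by exists z|by exists z0].
pose L := [set (u, f u) | u in B].
have LX : L \subset setX B [set: node d].
  by apply/subsetP=> _ /imsetP[u uB ->]; rewrite in_setX /= uB in_setT.
have cardL : #|L| = #|B| by rewrite card_imset // => u v [].
(* With D nodes, |H| > D|B| - (D - d)|Y| >= d|B| - (D - d)|S|. Removing [L], of size |B|, leaves at
   least (d - 1)|B| - (D - d)|S|, hence |B| - D|S| because d >= 2. *)
have [|R RH cardR] := @subset_of_card _ (H :\: L) (#|B| - #|node d| * #|S|).
  have := leq_mul d2 (leqnn #|B|).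
  have := leq_mul (leq_subr d #|node d|) (leqnn #|S|).
  have := leq_mul (leqnn (#|node d| - d)) cardYB; rewrite mulnDr.
  have := leq_mul dD (leqnn #|B|).
  have := cardsID L H; have := subset_leq_card (subsetIr H L); rewrite cardL.
  move: ltY le_card cellsB; rewrite !mulnBl.
  move: #|H| #|H :&: L| #|H :\: L| #|cells h Y| #|cells h B :\: _| => c1 c2 c3 c4 c5.
  move: (#|node d| * #|B|) (#|node d| * #|S|) (#|node d| * #|Y|) (d * #|B|) (d * #|Y|) (d * #|S|).
  lia.
apply/bigcupP; exists S => //; apply/bigcupP; exists B.
  rewrite eqxx -setI_eq0; apply/eqP/setP=> x; rewrite !inE.
  by case: (x \in S).
apply/bigcupP; exists L; first by rewrite !inE LX cardL eqxx.
apply/bigcupP; exists R.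
  rewrite !inE cardR eqxx andbT -setI_eq0; apply/andP; split.
    apply: subset_trans RH _; apply/subsetP=> q; rewrite !inE => /andP[_ /andP[/andP[]]].
    by move=> ->.
  apply/eqP/setP=> q; rewrite !inE; apply/andP=> -[qL /(subsetP RH)].
  by rewrite inE qL.
rewrite inE; apply/andP; split; last first.
  apply/forall_inP => _ /imsetP[q /(subsetP RH) + ->].
  by rewrite !inE => /andP[_ /andP[]].
apply/forall_inP => p; rewrite inE => /orP[/imsetP[q + ->]|/imsetP[_ /imsetP[u uB ->] ->]].
  by rewrite inE => /andP[/BA[gates _] _].
by have /andP[] := fP u uB.
Qed.

(** * Numerical estimates for the union bound *)

Lemma leq_ffact_exp (n k : nat) : n ^_ k <= n ^ k.
Proof.
elim: k => [|k IH]; first by rewrite ffactn0.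
by rewrite ffactnSr expnSr leq_mul // leq_subr.
Qed.

Lemma leq_bin_exp (n k : nat) : 'C(n, k) <= n ^ k.
Proof.
by rewrite (leq_trans _ (leq_ffact_exp n k)) // -bin_ffact leq_pmulr ?fact_gt0.
Qed.

Lemma leq_bin_2exp (n k : nat) : 'C(n, k) <= 2 ^ n.
Proof.
rewrite -(card_subsets n k) -[n in 2 ^ n]card_ord -[#|'I_n|]cardsT -card_powerset.
by apply/subset_leq_card/subsetP=> Y _; rewrite powersetE subsetT.
Qed.

(** Stands in for the bound (en/k)^k on the binomial: k^k is at most the falling factorial of 2k,
    which is C(2k, k) k!, and this k! turns C(n, k) into a falling factorial. *)
Lemma bin_mul_exp_self (n k : nat) : 'C(n, k) * k ^ k <= 4 ^ k * n ^ k.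
Proof.
have leff : k ^ k <= (k + k) ^_ k.
  rewrite ffact_prod; apply: (@leq_trans (\prod_(i < k) k)).
    by rewrite prod_nat_const card_ord.
  by apply: leq_prod => i _; have := ltn_ord i; lia.
rewrite (leq_trans (leq_mul (leqnn _) leff)) // -bin_ffact mulnCA.
rewrite bin_ffact leq_mul ?leq_ffact_exp //.
by rewrite (leq_trans (leq_bin_2exp _ _)) // addnn -mul2n expnM.
Qed.

(** The terms from index 1 on sum to at most N(1 - 8^-M)/7; denominators are cleared. *)
Lemma geometric_sum (a : nat -> nat) (N M : nat) :
    (forall y, 0 < y -> a y * 8 ^ y <= N) ->
  7 * 8 ^ M * \sum_(y < M) a y.+1 + N <= 8 ^ M * N.
Proof.
move=> aN; elim: M => [|M IH]; first by rewrite big_ord0 muln0 mul1n.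
rewrite big_ord_recr /=; have := aN M.+1 isT; rewrite expnS.
move: (\sum_(y < M) _) (8 ^ M) (a M.+1) IH => S E x; nia.
Qed.

Lemma leq_expn2r (a b e : nat) : a <= b -> a ^ e <= b ^ e.
Proof. by move=> ab; case: e => // e; rewrite leq_exp2r. Qed.

(** After [bin_mul_exp_self] both sides are [y]-th powers, and it suffices to compare bases. Of the
    constant, 2^(D + 5) = 4 * 2^D * 8 pays for the numerical factors and 2^(D + 3) for the power of
    D + 1 coming from the range of [y]. *)
Lemma crowded_arith (d m n s L D y : nat) :
    0 < L -> 2 <= d -> (D + 1) ^ d.-1 <= 2 ^ (D + 3) ->
    2 ^ (2 * D + 8) * m * n ^ d.-1 * L ^ d <= s ^ d ->
    y <= (D + 1) * L * n ->
  'C(m, y) * 2 ^ (y * D) * y ^ (d * y) * 8 ^ y <= s ^ (d * y).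
Proof.
move=> L0 d2 leD les ley.
have -> : y ^ (d * y) = y ^ y * (y ^ d.-1) ^ y.
  by rewrite -expnM -expnD; congr (_ ^ _); rewrite -[in LHS](prednK (ltnW d2)) mulSn.
have -> : 'C(m, y) * 2 ^ (y * D) * (y ^ y * (y ^ d.-1) ^ y) * 8 ^ y =
    ('C(m, y) * y ^ y) * (2 ^ D * y ^ d.-1 * 8) ^ y.
  by rewrite [y * D]mulnC !expnM !expnMn; ring.
rewrite (leq_trans (leq_mul (bin_mul_exp_self m y) (leqnn _))) //.
rewrite -!expnMn expnM leq_expn2r // (leq_trans _ les) //.
have -> : 2 ^ (2 * D + 8) = 2 ^ (D + 5) * 2 ^ (D + 3) by rewrite -expnD; congr expn; lia.
have -> : 4 * m * (2 ^ D * y ^ d.-1 * 8) = 2 ^ (D + 5) * (m * y ^ d.-1).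
  by rewrite expnD; ring.
rewrite -!mulnA leq_mul2l; apply/orP; right.
have : y ^ d.-1 <= ((D + 1) * L * n) ^ d.-1 by rewrite leq_expn2r.
rewrite !expnMn => le1; apply: leq_trans (leq_mul (leqnn m) le1) _.
have leL : L ^ d.-1 <= L ^ d by rewrite leq_pexp2l // leq_pred.
have le2 := leq_mul leD leL.
rewrite [leqLHS](_ : _ = m * n ^ d.-1 * ((D + 1) ^ d.-1 * L ^ d.-1)); last by ring.
rewrite [leqRHS](_ : _ = m * n ^ d.-1 * (2 ^ (D + 3) * L ^ d)); last by ring.
by rewrite leq_mul2l le2 orbT.
Qed.

(** The lower bound on [b] makes m^n and s^(D n) at most 2^b each. So choosing [S], and having D n
    collisions fewer than d b, costs only a constant factor per element of [B]. *)
Lemma overrun_arith (d m n s L D b : nat) :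
    0 < L -> 0 < D -> 0 < n -> 2 <= d -> s <= m -> m <= 2 ^ L ->
    2 ^ (2 * D + 8) * m * n ^ d.-1 * L ^ d <= s ^ d ->
    D * L * n <= b ->
  'C(m, n) * 'C(m, b) * (2 ^ (b * D) * 2 ^ (b * D)) *
      (n ^ (b * d.-1) * (n + b) ^ (b - D * n)) * 8 ^ b
    <= s ^ (b * d.-1 + (b - D * n)).
Proof.
move=> L0 D0 n0 d2 sm mL les leb; set r := b - D * n.
have DnL : D * n <= D * L * n by rewrite mulnAC leq_pmulr.
have nDn : n <= D * n by rewrite leq_pmull.
have nb : n <= b by lia.
have bE : b = r + D * n by rewrite /r; lia.
have b0 : 0 < b by lia.
have K0 : 0 < 2 ^ (2 * D + 8) by rewrite expn_gt0.
(* The factor b^b prepares for [bin_mul_exp_self], the other one for the [b]-th power of the space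
   hypothesis. *)
rewrite -(@leq_pmul2r (b ^ b * (2 ^ (2 * D + 8)) ^ b)); last by rewrite muln_gt0 !expn_gt0 b0.
have lem : m ^ n <= 2 ^ b.
  apply: leq_trans (_ : 2 ^ (L * n) <= _); first by rewrite expnM leq_expn2r.
  by rewrite leq_exp2l // (leq_trans _ leb) // -mulnA leq_pmull.
have lesb : s ^ (D * n) <= 2 ^ b.
  apply: leq_trans (_ : 2 ^ (L * (D * n)) <= _).
    by rewrite [leqRHS]expnM leq_expn2r // (leq_trans sm).
  by rewrite leq_exp2l // (leq_trans _ leb) //; lia.
have les1 : (m * n ^ d.-1 * 2 ^ (2 * D + 8)) ^ b <= s ^ (d * b).
  rewrite expnM leq_expn2r // (leq_trans _ les) //.
  by rewrite [leqRHS](_ : _ = m * n ^ d.-1 * 2 ^ (2 * D + 8) * L ^ d);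
    [rewrite leq_pmulr // expn_gt0 L0 | ring].
have ler : (n + b) ^ r <= 2 ^ b * b ^ r.
  apply: leq_trans (_ : (2 * b) ^ r <= _); first by rewrite leq_expn2r //; lia.
  by rewrite expnMn leq_mul // leq_exp2l // /r leq_subr.
have lec := bin_mul_exp_self m b.
have leS : 'C(m, n) <= 2 ^ b by rewrite (leq_trans (leq_bin_exp m n)).
have eLHS : 'C(m, n) * 'C(m, b) * (2 ^ (b * D) * 2 ^ (b * D)) *
    (n ^ (b * d.-1) * (n + b) ^ r) * 8 ^ b * (b ^ b * (2 ^ (2 * D + 8)) ^ b) =
    'C(m, n) * ('C(m, b) * b ^ b) * (n + b) ^ r *
    ((n ^ d.-1 * 2 ^ (2 * D + 8)) ^ b * (2 ^ (b * D) * 2 ^ (b * D) * 8 ^ b)).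
  have -> : n ^ (b * d.-1) = (n ^ d.-1) ^ b by rewrite mulnC expnM.
  by rewrite expnMn; ring.
rewrite {}eLHS.
apply: leq_trans (_ : 2 ^ b * (4 ^ b * m ^ b) * (2 ^ b * b ^ r) *
    ((n ^ d.-1 * 2 ^ (2 * D + 8)) ^ b * (2 ^ (b * D) * 2 ^ (b * D) * 8 ^ b)) <= _).
  by rewrite leq_mul2r; apply/orP; right; exact: leq_mul (leq_mul leS lec) ler.
rewrite [leqLHS](_ : _ = (m * n ^ d.-1 * 2 ^ (2 * D + 8)) ^ b * (2 ^ b * (4 ^ b * 2 ^ b *
    (2 ^ (b * D) * 2 ^ (b * D) * 8 ^ b) * b ^ r))); last by rewrite !expnMn; ring.
apply: leq_trans (leq_mul les1 (leqnn _)) _.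
have -> : s ^ (d * b) = s ^ (b * d.-1 + r) * s ^ (D * n).
  rewrite -expnD; congr expn; rewrite -[in LHS](prednK (ltnW d2)) mulSn mulnC; lia.
rewrite -!mulnA leq_mul2l; apply/orP; right.
have -> : b ^ b = b ^ r * b ^ (D * n) by rewrite -expnD -bE.
(* Per element, 2D pays for the two choices of positions, and 8 = 1 + 2 + 1 + 1 + 3 for C(m, n), the
   4^b of the binomial estimate, (n + b)^r, s^(D n) and the geometric factor 8^b. *)
have -> : (2 ^ (2 * D + 8)) ^ b =
    2 ^ b * (2 ^ b * (4 ^ b * (2 ^ b * (2 ^ (b * D) * (2 ^ (b * D) * 8 ^ b))))).
  by rewrite (_ : 4 = 2 ^ 2) // (_ : 8 = 2 ^ 3) // -!expnM -!expnD; congr expn; lia.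
apply: leq_trans (leq_mul lesb (leqnn _)) _.
rewrite [leqRHS](_ : _ = b ^ (D * n) * (2 ^ b * (2 ^ b * (4 ^ b * (2 ^ b * (2 ^ (b * D) * (2 ^ (b * D) * (8 ^ b * b ^ r)))))))); last by ring.
by rewrite leq_pmull // expn_gt0 b0.
Qed.

(** * Existence of a good hash *)

Lemma active_mono (m j d s : nat) (h : hash m j d s) (S S' : {set 'I_m}) :
  S \subset S' -> active h S \subset active h S'.
Proof.
move=> SS'; have hitS p : hit h S p -> hit h S' p.
  by move=> /exists_inP[x /(subsetP SS') xS' e]; apply/exists_inP; exists x.
apply/subsetP=> u; rewrite !inE => /orP[/(subsetP SS')->//|].
case/andP=> /forallP gates /existsP[z /andP[bz hz]]; apply/orP; right.
apply/andP; split; first by apply/forallP=> i; exact: hitS.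
by apply/existsP; exists z; rewrite bz hitS.
Qed.

(** Padding [S] to size [n] only enlarges the active set, so the union bound may run over sets of
    size exactly [n]. *)
Lemma good_exact (m j d s n : nat) (h : hash m j d s) :
    n <= m ->
    (forall S Y : {set 'I_m}, #|S| = n -> Y \subset active h S ->
      (#|node d| - d) * #|Y| <= #|cells h Y|) ->
  good n h.
Proof.
move=> nm goodn S Y leS YA.
have [|R RS cardR] := @subset_of_card _ (~: S) (n - #|S|).
  by have := cardsC S; rewrite card_ord; lia.
apply: (goodn (S :|: R)).
  rewrite cardsU cardR; have -> : S :&: R = set0.
    by apply/eqP; rewrite setI_eq0 disjoints_subset -setCS setCK.
  by rewrite cards0; lia.
by rewrite (subset_trans YA) // active_mono // subsetUl.
Qed.

(** With a cell per element in each array nothing collides. This settles the case where [s < m]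
    fails. *)
Lemma good_of_injective (m j d s n : nat) :
  m <= s -> exists h : hash m j d s, good n h.
Proof.
move=> ms; exists [ffun p => widen_ord ms p.1] => S Y _ _.
apply: (@leq_trans #|setX Y [set: node d]|).
  by rewrite cardsX cardsT mulnC leq_mul2l leq_subr orbT.
pose f (q : 'I_m * node d) := (q.2, widen_ord ms q.1).
rewrite -(card_imset (f := f)) => [|[u z] [v z'] [-> e]]; last first.
  by congr (_, _); apply: val_inj.
apply/subset_leq_card/subsetP=> _ /imsetP[[u z] + ->].
rewrite inE => /andP[uY _]; apply/bigcupP; exists u => //.
by apply/imsetP; exists z; rewrite ?ffunE.
Qed.

Lemma node_bounds (d : nat) :
  2 <= d -> d <= #|node d| /\ (#|node d| + 1) ^ d.-1 <= 2 ^ (#|node d| + 3).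
Proof.
move=> d2; have led : d < 2 ^ d by rewrite ltn_expl.
rewrite card_node subnK ?expn_gt0 // -expnM; split; first by rewrite expnS; lia.
(* As D + 1 = 2^(d + 1), the claim is (d + 1)(d - 1) <= 2^(d + 1) + 2, which is [key] at k = d -
   2. *)
rewrite leq_exp2l //; have key k : (k + 3) * (k + 1) <= 2 ^ (k + 3) + 2.
  elim: k => // k; have : k < 2 ^ k by rewrite ltn_expl.
  by rewrite !addSn !expnS !expnD; lia.
have := key (d - 2); have -> : d - 2 + 3 = d.+1 by lia.
have -> : d - 2 + 1 = d.-1 by lia.
have : 0 < 2 ^ d.+1 by rewrite expn_gt0.
lia.
Qed.

Lemma good_hash_exists (d m n s L : nat) :
    2 <= d -> 0 < n -> 0 < L -> m <= 2 ^ L ->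
    2 ^ (2 * #|node d| + 8) * m * n ^ d.-1 * L ^ d <= s ^ d ->
  exists h : hash m (d - 2) d s, good n h.
Proof.
set D := #|node d|; move=> d2 n0 L0 mL les.
have [|sm] := leqP m s; first exact: good_of_injective.
have m0 : 0 < m by lia.
have [dD leD] := node_bounds d2; rewrite -/D in dD leD.
have D0 : 0 < D by lia.
(* If n > m, the space hypothesis would give m <= s. *)
have nm : n <= m.
  rewrite leqNgt; apply/negP => ltmn.
  have : m ^ d <= s ^ d.
    apply: leq_trans les; apply: (@leq_trans (m * n ^ d.-1)).
      rewrite -[in leqLHS](prednK (ltnW d2)) expnS leq_mul2l.
      by rewrite leq_expn2r ?orbT // ltnW.
    rewrite [leqRHS](_ : _ = m * n ^ d.-1 * (2 ^ (2 * D + 8) * L ^ d)); last by ring.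
    by rewrite leq_pmulr // muln_gt0 !expn_gt0 L0.
  by rewrite leq_exp2r ?(ltnW d2) // => /(leq_trans sm); rewrite ltnn.
have s0 : 0 < s.
  have : 0 < s ^ d by apply: leq_trans les; rewrite !muln_gt0 !expn_gt0 m0 n0 L0.
  by rewrite expn_gt0; case/orP=> // /eqP d0; move: d2; rewrite d0.
apply: contrapT => nogood; pose N := #|hash m (d - 2) d s|.
have N0 : 0 < N by rewrite /N card_ffun expn_gt0 card_ord s0.
(* The thresholds fit together: if |Y| exceeds (D + 1) L n, removing the at most n elements of [S]
   leaves at least D L n. *)
pose F1 y := if y <= (D + 1) * L * n then crowded m (d - 2) d s y else set0.
pose F2 b := if D * L * n <= b then overrun m (d - 2) d s n b (b - D * n) else set0.
have card1 y : #|F1 y| * 8 ^ y <= N.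
  rewrite /F1; case: ifP => [ley|_]; last by rewrite cards0.
  rewrite -(@leq_pmul2r (s ^ (d * y))) ?expn_gt0 ?s0 // mulnAC.
  apply: leq_trans (leq_mul (card_crowded m (d - 2) d s y) (leqnn _)) _.
  have := crowded_arith L0 d2 leD les ley; rewrite -/D -/N => le1.
  rewrite [leqRHS]mulnC; apply: leq_trans (leq_mul le1 (leqnn N)).
  by rewrite !mulnA mulnAC.
have card2 b : #|F2 b| * 8 ^ b <= N.
  rewrite /F2; case: ifP => [leb|_]; last by rewrite cards0.
  rewrite -(@leq_pmul2r (s ^ (b * d.-1 + (b - D * n)))) ?expn_gt0 ?s0 // mulnAC.
  have := card_overrun m (d - 2) d s n b (b - D * n).
  have -> : b * (d - 2) + b = b * d.-1 by rewrite -mulnSr; congr muln; lia.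
  move=> le2; apply: leq_trans (leq_mul le2 (leqnn _)) _.
  have := overrun_arith L0 D0 n0 d2 (ltnW sm) mL les leb; rewrite -/D -/N => le1.
  rewrite [leqRHS]mulnC; apply: leq_trans (leq_mul le1 (leqnn N)).
  by rewrite !mulnA mulnAC.
(* The sum starts at size 1, since a violating [Y] is nonempty and so is [B] in the large case. *)
have covered : N <= \sum_(y < m) (#|F1 y.+1| + #|F2 y.+1|).
  rewrite /N -cardsT; apply: (@leq_trans #|\bigcup_(y < m) (F1 y.+1 :|: F2 y.+1)|).
    apply/subset_leq_card/subsetP=> h _.
    have : ~ good n h by move=> goodh; apply: nogood; exists h.
    move=> /(contra_not (good_exact nm)) /existsNP[S /existsNP[Y]].
    move=> /not_implyP[cardS /not_implyP[YA /negP]]; rewrite -ltnNge => ltY.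
    have leYm : #|Y| <= m by rewrite -[leqRHS]card_ord max_card.
    have [ley|lty] := leqP #|Y| ((D + 1) * L * n).
      have Y0 : 0 < #|Y|.
        by rewrite lt0n; apply/eqP=> Y0; rewrite Y0 muln0 in ltY.
      have ltYm : #|Y|.-1 < m by rewrite prednK.
      apply/bigcupP; exists (Ordinal ltYm) => //=; rewrite inE prednK // /F1 ley.
      by rewrite sub_crowded.
    have leB : D * L * n <= #|Y :\: S|.
      have := cardsID S Y; have := subset_leq_card (subsetIr Y S); rewrite cardS.
      have : n <= L * n by rewrite leq_pmull.
      by move: lty; rewrite mulnDl mul1n mulnDl; lia.
    have B0 : 0 < #|Y :\: S| by apply: leq_trans leB; rewrite !muln_gt0 D0 L0 n0.
    have leBm : #|Y :\: S| <= m by rewrite -[leqRHS]card_ord max_card.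
    have ltBm : #|Y :\: S|.-1 < m by rewrite prednK.
    apply/bigcupP; exists (Ordinal ltBm) => //=; rewrite inE prednK // /F2 leB.
    apply/orP; right; rewrite -cardS; apply: sub_overrun => //; first by rewrite d2.
    by rewrite cardS (leq_trans _ leB) // leq_mul2r leq_pmulr // orbT.
  elim/big_rec2: _ => [|i a X _ leX]; first by rewrite cards0.
  rewrite (leq_trans (leq_card_setU _ _)) // leq_add //.
  exact: leq_card_setU.
(* The bad events together cover less than 2N/7 of the [N] hashes, so they cannot cover all of
   them. *)
have := @geometric_sum (fun y => #|F1 y| + #|F2 y|) (N + N) m.
have sum8 y : (#|F1 y| + #|F2 y|) * 8 ^ y <= N + N by rewrite mulnDl leq_add.
move=> /(_ (fun y _ => sum8 y)) /=.
have : 0 < 8 ^ m by rewrite expn_gt0.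
move: (\sum_(y < m) _) covered (8 ^ m) => S leS E E0; nia.
Qed.

(** * The space bound, first in integers, then with real powers *)

(** There are d - 2 gate arrays and 2^(d + 1) - 1 node arrays, hence at most 2^(d + 2) arrays of
    size [s]. *)
Lemma min_space_le (m n d s L : nat) :
    2 <= d -> 0 < n -> 0 < L -> m <= 2 ^ L ->
    2 ^ (2 * #|node d| + 8) * m * n ^ d.-1 * L ^ d <= s ^ d ->
  min_space m n (2 * d).-1 <= 2 ^ (d + 2) * s.
Proof.
move=> d2 n0 L0 mL les.
have [h goodh] := good_hash_exists d2 n0 L0 mL les.
have := scheme_of_hash goodh; have -> : d - 2 + d.+1 = (2 * d).-1 by lia.
have t0 : 0 < (2 * d).-1 by lia.
move=> /(min_spaceP m n t0).2 /leq_trans; apply.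
rewrite card_prod card_sum !card_ord leq_mul2r card_node; apply/orP; right.
have : d < 2 ^ d by rewrite ltn_expl.
by rewrite !expnS addn2 !expnS; lia.
Qed.

Local Open Scope ring_scope.

Lemma expR_nat_ge (R : realType) (k : nat) : (2 ^ k)%:R <= expR (k%:R : R).
Proof.
rewrite -[k%:R]mulr1 expRM_natl natrX lerXn2r ?nnegrE ?expR_ge0 //.
by have := expR_ge1Dx (1 : R); lra.
Qed.

Lemma powR_invn_exp (R : realType) (a : R) (d : nat) :
  (0 < d)%N -> 0 <= a -> (a `^ d%:R^-1) ^+ d = a.
Proof.
move=> d0 a0; rewrite -powR_mulrn ?powR_ge0 // -powRrM mulVf ?powRr1 //.
by rewrite pnatr_eq0 -lt0n.
Qed.

Lemma powR_ge1 (R : realType) (n : nat) (x : R) :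
  (0 < n)%N -> 0 <= x -> 1 <= (n%:R : R) `^ x.
Proof.
move=> n0 x0; have n1 : (1 : R) <= n%:R by rewrite ler1n.
by have := ler_powR n1 x0; rewrite powRr0.
Qed.

Unset Implicit Arguments.

Theorem theorem5 (R : realType) (eps : R) (eps_gt0 : 0 < eps) :
  exists (C : R) (m0 : nat), forall m t n : nat,
    (m0 <= m)%N ->
    odd t -> (3 <= t)%N -> t%:R <= 1 / 10%:R * lg (lg (m%:R : R)) ->
    (0 < n)%N -> n%:R <= (m%:R : R) `^ (1 - eps) ->
    (min_space m n t)%:R <=
      C * (expR (expR (2 * t%:R))
           * m%:R `^ (2 / (t%:R + 1))
           * n%:R `^ (1 - 2 / (t%:R + 1))
           * lg m%:R).
Proof.
(* The double exponential absorbs all constants, so [C = 1] suffices; [m >= 2] makes the integer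
   part of lg m positive. *)
exists 1, 2 => m t n m2 t_odd t3 _ n0 _; rewrite mul1r.
(* With d = (t + 1)/2 the exponents become 1/d and 1 - 1/d. *)
have [d [d2 tE]] : exists d, (2 <= d)%N /\ t = (2 * d).-1.
  by exists t./2.+1; have := odd_double_half t; rewrite t_odd -addnn; lia.
rewrite {}tE {t t_odd t3}; set t := (2 * d).-1.
have d0 : (0 < d)%N by lia.
have dR : (0 : R) < d%:R by rewrite ltr0n.
have -> : 2 / (t%:R + 1) = d%:R^-1 :> R.
  rewrite natr1 (_ : t.+1 = (2 * d)%N) ?natrM; last by rewrite /t; lia.
  by field; rewrite gt_eqF.
set D := #|node d|; set K := (2 ^ (2 * D + 8))%N; set l := trunc_log 2 m.
pose a := (m%:R : R) `^ d%:R^-1; pose b := (n%:R : R) `^ (1 - d%:R^-1).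
rewrite -/a -/b.
have invd : d%:R^-1 <= (1 : R) by rewrite invf_le1 // ler1n.
have a1 : 1 <= a by rewrite powR_ge1 ?invr_ge0 ?ltW //; lia.
have b1 : 1 <= b by rewrite powR_ge1 // subr_ge0.
have l0 : (0 < l)%N by rewrite trunc_log_gt0.
have ml : (m <= 2 ^ l.+1)%N by rewrite ltnW // trunc_log_ltn.
have lg_ge : l%:R <= lg (m%:R : R).
  rewrite /lg ler_pdivlMr ?ln_gt0 ?ltr1n // mulr_natl -lnXn ?ltr0n //.
  by rewrite ler_ln ?posrE ?exprn_gt0 ?ltr0n -?natrX ?ler_nat ?trunc_logP //; lia.
(* [X] is a real solution of the space hypothesis, with [K] itself in place of its [d]-th root, as K
   <= K^d. Since X >= 1, rounding up to [s] at most doubles it. *)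
pose X : R := K%:R * a * b * l.+1%:R; pose s := (Num.truncn X).+1.
have K1 : (1 : R) <= K%:R by rewrite ler1n expn_gt0.
have X1 : 1 <= X.
  by rewrite /X !mulr_ege1 // ler1n.
have ltXs : X < s%:R by exact: truncnS_gt.
have lesX : s%:R <= 2 * X.
  have : (Num.truncn X)%:R <= X.
    by have := truncn_itv (le_trans ler01 X1) => /andP[].
  by rewrite /s -natr1; lra.
have les : (2 ^ (2 * D + 8) * m * n ^ d.-1 * l.+1 ^ d <= s ^ d)%N.
  rewrite -(ler_nat R) !natrM !natrX.
  apply: le_trans (_ : X ^+ d <= _); last by rewrite lerXn2r ?nnegrE ?ltW // (lt_le_trans ltr01).
  have bd : b ^+ d = n%:R ^+ d.-1.
    rewrite -powR_mulrn ?powR_ge0 // -powRrM mulrBl mul1r mulVf ?gt_eqF //.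
    by rewrite -powR_mulrn ?ler0n // -(natrB _ d0) subn1.
  rewrite /X !exprMn bd powR_invn_exp // -!natrX.
  rewrite !ler_pM2r ?ltr0n ?expn_gt0 ?n0 //; last by lia.
  by rewrite ler_nat -[leqLHS]expn1 leq_pexp2l // expn_gt0.
have := @min_space_le m n d s l.+1 d2 n0 (ltn0Sn l) ml les.
rewrite -(ler_nat R) => /le_trans; apply.
have leL : l.+1%:R <= 2 * lg (m%:R : R).
  have l1 : (1 : R) <= l%:R by rewrite ler1n.
  by rewrite -[l.+1%:R]natr1; move: l1 lg_ge; lra.
(* Beyond 2^(d + 2) for the arrays, one factor 2 comes from rounding [X] and one from [leL]. The
   exponent of 2 in the whole product is at most 16 * 2^d, hence at most 2^(2t). *)
have leE : (2 ^ (d + 4) * K)%:R <= expR (expR (2 * t%:R)) :> R.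
  apply: le_trans (_ : expR (2 ^ (2 * t))%:R <= _); last first.
    by rewrite ler_expR -natrM expR_nat_ge.
  apply: le_trans (expR_nat_ge R _); rewrite ler_nat /K -expnD leq_exp2l //.
  rewrite /D card_node.
  have -> : (2 * t = (d - 2) + (d - 2) + (d - 2) + (d.+1 + 3))%N by rewrite /t; lia.
  rewrite !expnD; have : (d < 2 ^ d)%N by rewrite ltn_expl.
  have : (0 < 2 ^ (d - 2))%N by rewrite expn_gt0.
  have : (4 <= 2 ^ d)%N by rewrite -[4%N]/(2 ^ 2)%N leq_exp2l.
  move=> x4 y0 ltd; apply: (@leq_trans (2 ^ d.+1 * 2 ^ 3)).
    by move: x4 ltd; rewrite expnS; lia.
  by rewrite leq_pmull // !muln_gt0 y0.
rewrite natrM; apply: le_trans (ler_wpM2l (ler0n _ _) lesX) _.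
have ab0 : 0 <= a * b by rewrite mulr_ge0 // powR_ge0.
apply: le_trans (_ : (2 ^ (d + 4) * K)%:R * (a * b * lg m%:R) <= _).
  rewrite expnD natrM natrM /X.
  have := ler_wpM2l (mulr_ge0 (mulr_ge0 (ler0n R (2 ^ (d + 2))) (ler0n R K)) ab0) leL.
  rewrite !expnD !natrM; lra.
have lg0 : 0 <= lg (m%:R : R) by apply: le_trans lg_ge; rewrite ler0n.
move: (lg _) lg0 => q q0.
by rewrite -!mulrA ler_wpM2r // mulrA mulr_ge0.
Qed.
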